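(* Let $G=(V,E)$ be an $n$-vertex graph with minimum degree $\delta(G)\ge 3n/4$, where $n$ is even. If the edges of $G$ are colored red and blue, then there exist a red connected matching and a vertex-disjoint blue connected matching which together form a perfect matching of $G$.
   Context: A red (resp. blue) connected matching is a matching of red (resp. blue) edges all lying in a single connected component of the subgraph formed by the red (resp. blue) edges of $G$; the empty matching is allowed. *)

(* Defs.v *)
From mathcomp Require Import all_boot.

Set Implicit Arguments.
Unset Strict Implicit.
Unset Printing Implicit Defensive.

(* A simple graph on V is given by a symmetric irreflexive adjacency relation;
   its edges are two-element subsets of V. *)
Definition simple_graph (V : finType) (adj : rel V) : Prop :=
  symmetric adj /\ irreflexive adj.

Definition edges (V : finType) (adj : rel V) : {set {set V}} :=
  [set [set x; y] | x in [set: V], y in [set: V] & adj x y].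

Definition degree (V : finType) (adj : rel V) (x : V) : nat :=
  #|[set y | adj x y]|.

(* Degrees are smaller than #|V|, so the default #|V| never affects the minimum
   over a nonempty V; for empty V the value is 0. *)
Definition min_degree (V : finType) (adj : rel V) : nat :=
  \big[minn/#|V|]_(x : V) degree adj x.

Inductive color := red | blue.

Definition same_color (a b : color) : bool :=
  match a, b with
  | red, red | blue, blue => true
  | _, _ => false
  end.

(* A coloring is total on {set V}; only its values on edges are ever used. *)
Definition color_edges (V : finType) (adj : rel V) (col : {set V} -> color)
    (a : color) : {set {set V}} :=
  [set f in edges adj | same_color (col f) a].

Definition color_adj (V : finType) (adj : rel V) (col : {set V} -> color)
    (a : color) : rel V :=
  [rel x y | [set x; y] \in color_edges adj col a].

(* Vertices with no incident edge of adj form singleton components; these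
   contain no edge. *)
Definition components (V : finType) (adj : rel V) : {set {set V}} :=
  equivalence_partition (connect adj) [set: V].

Definition matching (V : finType) (adj : rel V) (M : {set {set V}}) : Prop :=
  M \subset edges adj /\ trivIset M.

Definition perfect_matching (V : finType) (adj : rel V) (M : {set {set V}})
    : Prop :=
  matching adj M /\ cover M = [set: V].

(* The first disjunct matters only when V is empty, where there is no component
   at all. *)
Definition connected_matching (V : finType) (adj : rel V)
    (col : {set V} -> color) (a : color) (M : {set {set V}}) : Prop :=
  [/\ matching adj M,
      M \subset color_edges adj col a
    & M = set0 \/
      exists2 C, C \in components (color_adj adj col a) & cover M \subset C].

(* Main.v *)
Require Import Defs.
From Stdlib Require Import Classical.
From mathcomp Require Import all_boot perm zify.

Set Implicit Arguments.
Unset Strict Implicit.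
Unset Printing Implicit Defensive.

(** Choose a red component R and a blue component B, and keep only the red edges
    inside R and the blue edges inside B: a perfect matching of the remaining
    graph H is what is wanted, so suppose that H has a Tutte barrier S.
    Edges of G between different components of H - S have been deleted.
    If neither color is connected, then both colors have a component missing
    fewer than n/4 vertices, and two components of H - S are already too large
    to coexist with the others.  If red, say, is connected, take for B a largest
    blue component: a component of H - S meeting B would force a blue component
    with more than n/2 vertices disjoint from B; so B is contained in S, which
    has to be so large that many components of H - S are single vertices.  These
    lie in one blue component, and a vertex outside S and that component is
    adjacent to none of them, contradicting the degree condition. *)

(** * Tutte's theorem, by Lovasz's saturation argument *)

(** A perfect matching as the involution swapping the ends of its edges; irreflexivity of [e]
    excludes fixed points. *)
Definition perfect_pairing (V : finType) (e : rel V) (f : V -> V) : Prop :=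
  involutive f /\ forall x, e x (f x).

Definition add_edge (V : finType) (e : rel V) (a c : V) : rel V :=
  [rel x y | e x y || ((x == a) && (y == c) || (x == c) && (y == a))].

(* The core of Lovasz's proof of Tutte's theorem: [f] is a perfect matching of
   [e + ac], [g] one of [e + bd] with [d = g b].  Instead of walking along an
   alternating path, move the end [d] of the virtual edge so as to increase the
   number of edges that [g] shares with [f]. *)
Lemma pairing_exchange (V : finType) (e : rel V) (a b c : V) (f g : V -> V) :
  symmetric e -> irreflexive e -> e a b -> e c b ->
  involutive f -> (forall x, x != a -> x != c -> e x (f x)) ->
  involutive g -> g b != b -> (forall x, x != b -> x != g b -> e x (g x)) ->
  exists h, perfect_pairing e h.
Proof.
move=> esym eirr eab ecb fK fe.
have [k] := ubnP (#|V| - #|[set v | g v == f v]|).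
elim: k g => // k IH g lek gK gb ge.
have done_if : e b (g b) -> exists h, perfect_pairing e h.
  move=> ebx; exists g; split=> // v.
  have [->//|vb] := eqVneq v b; have [->|vx] := eqVneq v (g b).
    by rewrite gK esym.
  exact: ge.
set x := g b in gb ge done_if *.
have gx : g x = b by rewrite /x gK.
have [xa|xa] := eqVneq x a; first by apply: done_if; rewrite xa esym.
have [xc|xc] := eqVneq x c; first by apply: done_if; rewrite xc esym.
have exy : e x (f x) by apply: fe.
set y := f x in exy.
have fy : f y = x by rewrite /y fK.
have [yb|yb] := eqVneq y b; first by apply: done_if; rewrite esym -yb.
have yx : y != x by apply: contraTneq exy => ->; rewrite eirr.
have eyz : e y (g y) by apply: ge.
set z := g y in eyz.
have gz : g z = y by rewrite /z gK.
have zy : z != y by apply: contraTneq eyz => ->; rewrite eirr.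
have zx : z != x by apply: contra_neq yb => zx; rewrite -gz zx gx.
(* Conjugation by the transposition defined next turns the pairs bx, yz of [g] into bz, xy: the
   virtual edge becomes bz, and xy is a pair of [f]. *)
have zb : z != b by apply: contra_neq yx => zb; rewrite -gz zb.
pose t := tperm x z; pose g' v := t (g (t v)).
have g'K : involutive g' by move=> v; rewrite /g' tpermK gK tpermK.
have g'b : g' b = z by rewrite /g' /t (tpermD gb zb) -/x tpermL.
have g'x : g' x = y by rewrite /g' /t tpermL gz tpermD // eq_sym.
have g'y : g' y = x by rewrite -g'x g'K.
have g'E v : v != b -> v != x -> v != y -> v != z -> g' v = g v.
  move=> vb vx vy vz; rewrite /g' /t (@tpermD _ x z v) 1?eq_sym // tpermD //.
    by apply: contra_neq vb => xv; rewrite -gx xv gK.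
  by apply: contra_neq vy => zv; rewrite -gz zv gK.
apply: (IH g') => //; last 2 first.
- by rewrite g'b.
- move=> v vb; rewrite g'b => vz.
  have [->|vx] := eqVneq v x; first by rewrite g'x.
  have [->|vy] := eqVneq v y; first by rewrite g'y esym.
  by rewrite g'E //; apply: ge.
suff lt : #|[set v | g v == f v]| < #|[set v | g' v == f v]|.
  rewrite -ltnS; apply: leq_trans lek; rewrite ltnS.
  by apply: (ltn_sub2l _ lt); apply: leq_trans lt (max_card _).
apply: proper_card; apply/properP; split; last first.
  by exists x; rewrite inE ?g'x // gx eq_sym.
apply/subsetP => v; rewrite !inE => /eqP gv; apply/eqP.
(* At b, x, y and z the pairings [f] and [g] disagree, so no agreement is lost. *)
have vx : v != x by apply: contra_neq yb => vx; rewrite /y -vx -gv vx.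
have vb : v != b.
  by apply: contra_neq yb => vb; rewrite /y /x -vb gv fK.
have vy : v != y by apply: contra_neq zx => vy; rewrite -fy -vy -gv vy.
have vz : v != z by apply: contra_neq zx => vz; rewrite -fy -gz -vz gv fK.
by rewrite g'E.
Qed.

(** If ac were missing, saturation would give matchings of [e + ac] and [e + bd]. Either the second
    avoids bd, or the exchange combines the two; both ways [e] has a matching. *)
Lemma saturated_trans (V : finType) (e : rel V) (a b c d : V) :
  symmetric e -> irreflexive e -> ~ (exists f, perfect_pairing e f) ->
  (forall x y, x != y -> ~~ e x y -> exists f, perfect_pairing (add_edge e x y) f) ->
  b != d -> ~~ e b d -> e a b -> e b c -> a != c -> e a c.
Proof.
move=> esym eirr nopm sat bd nbd eab ebc ac; apply/negPn/negP => nac.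
apply: nopm; have [f [fK fe]] := sat _ _ ac nac.
have [g [gK ge]] := sat _ _ bd nbd.
have fe' x : x != a -> x != c -> e x (f x).
  by move=> /negPf xa /negPf xc; have := fe x; rewrite /add_edge /= xa xc /= orbF.
have [gb|gb] := eqVneq (g b) d.
  apply: (@pairing_exchange _ e a b c f g) => //; first by rewrite esym.
    by rewrite gb eq_sym.
  move=> x /negPf xb; rewrite gb => /negPf xd.
  by have := ge x; rewrite /add_edge /= xb xd /= orbF.
exists g; split=> // x.
have := ge x; rewrite /add_edge /=.
case/or3P=> [//|/andP[/eqP-> gxd]|/andP[/eqP -> /eqP gd]].
  by rewrite gxd in gb.
by rewrite -gd gK eqxx in gb.
Qed.

(** A matching of the vertices of [W] only, with [f] arbitrary elsewhere, so that pairs can be split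
    off one at a time. *)
Definition pairing_on (V : finType) (e : rel V) (W : {set V}) : Prop :=
  exists f : V -> V, {in W, forall x, [/\ f x \in W, f (f x) = x & e x (f x)]}.

Lemma pairing_on_add (V : finType) (e : rel V) (W : {set V}) (x y : V) :
  symmetric e -> x \in W -> y \in W -> e x y -> x != y ->
  pairing_on e (W :\: [set x; y]) -> pairing_on e W.
Proof.
move=> esym xW yW exy xy [f fP].
exists (fun v => if v == x then y else if v == y then x else f v) => v vW.
have [->|vx] := eqVneq v x; first by rewrite eqxx eq_sym (negPf xy).
have [->|vy] := eqVneq v y; first by rewrite eqxx esym.
have [|] := fP v; first by rewrite !inE vW negb_or vx vy.
rewrite !inE negb_or => /andP[/andP[/negPf-> /negPf->] ->] -> ->.
by [].
Qed.

Lemma odd_setID2 (V : finType) (D W : {set V}) (x y : V) :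
  x \in W -> y \in W -> x != y -> (x \in D) = (y \in D) ->
  odd #|D :&: (W :\: [set x; y])| = odd #|D :&: W|.
Proof.
move=> xW yW xy DxDy; rewrite -(cardsID [set x; y] (D :&: W)) setIDA oddD.
suff -> : odd #|D :&: W :&: [set x; y]| = false by [].
have [xD|xD] := boolP (x \in D).
  suff -> : D :&: W :&: [set x; y] = [set x; y] by rewrite cards2 xy.
  by apply/setIidPr; rewrite subUset !sub1set !inE xD -DxDy xD xW.
suff -> : D :&: W :&: [set x; y] = set0 by rewrite cards0.
apply/setP=> v; rewrite !inE; apply/negP => /andP[/andP[vD _]].
by case/orP=> /eqP E; move: vD xD; rewrite E ?DxDy => ->.
Qed.

(** Greedy matching: pair inside blocks until each has at most one vertex left, join these leftovers
    to [S], then pair the rest of [S] internally. This fails only if the leftovers outnumber [S], by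
    parity by at least 2. *)
Lemma pairing_on_cliques (V : finType) (e : rel V) (S : {set V})
    (P : {set {set V}}) (W : {set V}) :
  symmetric e -> partition P (~: S) ->
  (forall s v, s \in S -> s != v -> e s v) ->
  (forall D x y, D \in P -> x \in D -> y \in D -> x != y -> e x y) ->
  ~~ odd #|W| ->
  pairing_on e W \/ #|S :&: W| + 2 <= #|[set D in P | odd #|D :&: W|]|.
Proof.
move=> esym pP univ cliq.
have tP := partition_trivIset pP.
have PS D : D \in P -> D \subset ~: S.
  by move=> DP; rewrite -(cover_partition pP); apply: bigcup_sup.
have [k] := ubnP #|W|; elim: k W => // k IH W lek evW.
have IH2 x y : x \in W -> y \in W -> x != y ->
    let W' := W :\: [set x; y] in
    pairing_on e W' \/ #|S :&: W'| + 2 <= #|[set D in P | odd #|D :&: W'|]|.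
  move=> xW yW xy W'.
  have cW : #|W'| + 2 = #|W|.
    rewrite -(cardsID [set x; y] W) addnC; congr (_ + _).
    suff -> : W :&: [set x; y] = [set x; y] by rewrite cards2 xy.
    by apply/setIidPr; rewrite subUset !sub1set xW.
  by apply: IH; move: lek evW; rewrite -cW -/W'; move: #|W'| => m; clear; lia.
have [/exists_inP[D DP /exists_inP[x xDW /exists_inP[y yDW xy]]]|noD] :=
  boolP [exists D in P, exists x in D :&: W, exists y in D :&: W, x != y].
  move: xDW yDW; rewrite !inE => /andP[xD xW] /andP[yD yW].
  have [pW|le] := IH2 x y xW yW xy.
    by left; apply: pairing_on_add pW => //; exact: cliq DP xD yD xy.
  right; have xS := subsetP (PS _ DP) _ xD; have yS := subsetP (PS _ DP) _ yD.
  suff [<- <-] : S :&: (W :\: [set x; y]) = S :&: W /\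
    [set D in P | odd #|D :&: (W :\: [set x; y])|] = [set D in P | odd #|D :&: W|].
    exact: le.
  split.
    apply/setP=> v; rewrite !inE negb_or; move: xS yS; rewrite !inE.
    have [->|] := eqVneq v x; first by move=> /negPf->.
    by have [->|] := eqVneq v y; first by move=> _ _ /negPf->.
  apply/setP=> D'; rewrite !inE; apply: andb_id2l => D'P.
  apply: odd_setID2 => //.
  apply/idP/idP=> vD'; first by rewrite -(def_pblock tP D'P vD') (def_pblock tP DP xD).
  by rewrite -(def_pblock tP D'P vD') (def_pblock tP DP yD).
have one D x y : D \in P -> x \in D -> x \in W -> y \in D -> y \in W -> x = y.
  move=> DP xD xW yD yW; apply/eqP; apply: contraR noD => xy.
  by apply/exists_inP; exists D => //; apply/exists_inP; exists x;
     [rewrite inE xD | apply/exists_inP; exists y; rewrite // inE yD].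
have card_one v D : D \in P -> v \in D -> v \in W -> D :&: W = [set v].
  move=> DP vD vW; apply/setP=> u; rewrite !inE.
  by apply/andP/eqP => [[uD uW]|->//]; apply: one uD uW vD vW.
have blockW v : v \in W -> v \notin S -> v \in pblock P v /\ pblock P v \in P.
  move=> vW vS; have vP : v \in cover P by rewrite (cover_partition pP) inE.
  by rewrite mem_pblock vP pblock_mem.
(* Once [S] is used up, evenness of [W] gives any leftover vertex a companion in another block, and
   both blocks are odd. *)
have [WS0|[s /setIP[sS sW]]] := set_0Vmem (S :&: W).
  have WS v : v \in W -> v \notin S.
    by move=> vW; apply/negP=> vS; have := in_set0 v; rewrite -WS0 inE vS vW.
  have [W0|[x xW]] := set_0Vmem W.
    by left; exists id => v; rewrite W0 inE.
  have [W0|[y]] := set_0Vmem (W :\ x).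
    by move: evW; rewrite (cardsD1 x W) xW W0 cards0.
  rewrite 2!inE => /andP[yx yW]; right; rewrite WS0 cards0 add0n.
  have [xB BP] := blockW x xW (WS _ xW); have [yB CP] := blockW y yW (WS _ yW).
  have BC : pblock P x != pblock P y.
    by apply: contra_neq yx => BC; apply: (one _ _ _ CP) => //; rewrite -BC.
  have <- : #|[set pblock P x; pblock P y]| = 2 by rewrite cards2 BC.
  apply: subset_leq_card; rewrite subUset !sub1set !inE BP CP.
  by rewrite (card_one x) // (card_one y) // !cards1.
(* Pairing a vertex of [S] with a leftover costs one vertex of [S] and one odd block, so the surplus
   is unchanged. *)
have [/exists_inP[v vW vS]|noV] := boolP [exists v in W, v \notin S].
  have sv : s != v by apply: contraNneq vS => <-.
  have [pW|le] := IH2 s v sW vW sv.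
    by left; apply: pairing_on_add pW => //; apply: univ.
  have [vB BP] := blockW v vW vS; right.
  set Q' := [set D in P | _] in le.
  have BQ' : pblock P v \notin Q'.
    suff E : pblock P v :&: (W :\: [set s; v]) = set0 by rewrite !inE E cards0 andbF.
    apply/setP=> u; rewrite setIDA (card_one v) // !inE.
    by case: (u == v); rewrite ?orbT ?andbF.
  have cS : #|S :&: W| = #|S :&: (W :\: [set s; v])| + 1.
    rewrite (cardsD1 s (S :&: W)) inE sS sW addnC; congr (#|pred_of_set _| + _).
    apply/setP=> u; rewrite !inE negb_or.
    by have [->|] := eqVneq u v; rewrite ?(negPf vS) ?andbF //= andbCA andbT.
  suff sub : pblock P v |: Q' \subset [set D in P | odd #|D :&: W|].
    apply: leq_trans (subset_leq_card sub).
    by rewrite cardsU1 BQ' cS addnAC addn1 add1n ltnS.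
  apply/subsetP=> D; rewrite 2!inE => /orP[/eqP->|].
    by rewrite inE BP (card_one v) // cards1.
  rewrite !inE => /andP[DP]; rewrite DP /=.
  suff -> : D :&: (W :\: [set s; v]) = (D :&: W) :\ v.
    have [vD|vD] := boolP (v \in D :&: W).
      by rewrite (card_one v) ?setDv ?cards0 //; case/setIP: vD.
    rewrite (cardsD1 v (D :&: W)) (negPf vD); exact.
  apply/setP=> u; rewrite !inE negb_or.
  have [->|] := eqVneq u s; last by rewrite /= andbCA.
  suff /negPf -> : s \notin D by rewrite !andbF.
  by apply/negP=> /(subsetP (PS D DP)); rewrite inE sS.
have {noV} WS v : v \in W -> v \in S.
  by move=> vW; apply: contraR noV => vS; apply/exists_inP; exists v.
have [W0|[y]] := set_0Vmem (W :\ s).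
  by move: evW; rewrite (cardsD1 s W) sW W0 cards0.
rewrite 2!inE => /andP[ys yW]; have sy : s != y by rewrite eq_sym.
have [pW|] := IH2 s y sW yW sy.
  by left; apply: pairing_on_add pW => //; apply: univ.
(* All of [W] lies in [S], so no block is odd and the inequality for the smaller set is absurd. *)
suff -> : [set D in P | odd #|D :&: (W :\: [set s; y])|] = set0.
  by rewrite cards0 addn2.
apply/setP=> D; rewrite !inE; apply/negP=> /andP[DP].
suff -> : D :&: (W :\: [set s; y]) = set0 by rewrite cards0.
apply/setP=> u; rewrite !inE; apply/negP => /and3P[uD _ uW].
by have := subsetP (PS D DP) u uD; rewrite inE WS.
Qed.

(* The blocks of [P] are unions of components of [e - S], not necessarily single
   components.  The surplus of odd blocks is at least 2 by parity. *)
Definition barrier (V : finType) (e : rel V) (S : {set V}) (P : {set {set V}}) :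
    Prop :=
  [/\ partition P (~: S),
    forall D x y, D \in P -> x \in D -> y \notin S -> e x y -> y \in D
    & #|S| + 2 <= #|[set D in P | odd #|D| ]|].

(** Add edges as long as no pairing appears; a barrier of the larger graph is one of [e]. In a
    saturated graph let [S] be the set of vertices adjacent to all others: off [S] adjacency is
    transitive, so the blocks are cliques. *)
Theorem tutte (V : finType) (e : rel V) :
  symmetric e -> irreflexive e -> ~~ odd #|V| ->
  (exists f, perfect_pairing e f) \/
  exists S P, barrier e S P.
Proof.
move=> + + evV; have [k] := ubnP #|[set p : V * V | ~~ e p.1 p.2]|.
elim: k e => // k IH e lek esym eirr.
have [[x [y [xy nexy nopm]]]|sat] := classic (exists x y, [/\ x != y, ~~ e x y
    & ~ exists f, perfect_pairing (add_edge e x y) f]).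
  have [|||pm|[S [P [pP cross le]]]] := IH (add_edge e x y).
  - apply: leq_trans (_ : #|_| < _) _; last exact: lek.
    apply: proper_card; apply/properP; split.
      by apply/subsetP=> -[u v]; rewrite !inE negb_or => /andP[].
    by exists (x, y); rewrite !inE /add_edge /= ?eqxx ?orbT.
  - move=> u v; rewrite /add_edge /= esym orbC [in RHS]orbC; congr (_ || _).
    by rewrite orbC; congr (_ || _); apply: andbC.
  - move=> u; rewrite /add_edge /= eirr /=; apply/negP.
    by case/orP=> /andP[/eqP-> /eqP E]; move: xy; rewrite E eqxx.
  - by [].
  right; exists S, P; split=> // D u v DP uD vS euv; apply: (cross D u v) => //.
  by rewrite /add_edge /= euv.
have [|nopm] := classic (exists f, perfect_pairing e f); first by left.
have {}sat x y : x != y -> ~~ e x y -> exists f, perfect_pairing (add_edge e x y) f.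
  move=> xy nxy.
  have [//|nop] := classic (exists f, perfect_pairing (add_edge e x y) f).
  by case: sat; exists x, y.
pose S := [set s | [forall v, (s != v) ==> e s v]].
pose R := [rel x y | (x == y) || e x y].
(* A middle vertex outside [S] has a non-neighbour, the fourth vertex that [saturated_trans]
   requires. *)
have trans x y z : y \in ~: S -> e x y -> e y z -> x != z -> e x z.
  rewrite !inE => /forallPn[d]; rewrite negb_imply => /andP[yd nyd].
  exact: (saturated_trans esym eirr nopm sat yd nyd).
have eqR : {in ~: S & &, equivalence_rel R}.
  move=> x y z xS yS _; split; rewrite /= ?eqxx // => /orP[/eqP->//|exy].
  have [<-|xz] := eqVneq x z; first by rewrite esym exy orbT.
  have [<-|yz] := eqVneq y z; first by rewrite exy.
  by apply/idP/idP => /= h; [apply: (trans y x z) | apply: (trans x y z)];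
    rewrite // esym.
pose P := equivalence_partition R (~: S).
have pP : partition P (~: S) := equivalence_partitionP eqR.
have inP D x y : D \in P -> x \in D -> (y \in D) = (y \in ~: S) && R x y.
  case/imsetP=> w wS -> {D}; rewrite !in_set => /andP[xS wx].
  apply: andb_id2l => yS; have [|||_ ->] := eqR w x y; rewrite ?in_set //.
  by move: wS; rewrite !in_set.
have [|||[f fP]|le] := @pairing_on_cliques V e S P setT esym pP.
- by move=> s v; rewrite inE => /forallP/(_ v)/implyP.
- move=> D x y DP xD; rewrite (inP D x) // => /andP[_ /orP[/eqP->|//]].
  by rewrite eqxx.
- by rewrite cardsT.
- by case: nopm; exists f; split=> x; case: (fP x).
right; exists S, P; split=> //.
  by move=> D x y DP xD yS exy; rewrite (inP D x) // inE yS /= exy orbT.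
by move: le; rewrite setIT; under eq_finset => D do rewrite setIT.
Qed.

(** * Block sizes and monochromatic components *)

(** Each block outside [Q] has at least one vertex; |Q| stands on the right to avoid subtraction. *)
Lemma sum_blocks (V : finType) (S : {set V}) (P Q : {set {set V}}) :
  partition P (~: S) -> Q \subset P ->
  \sum_(D in Q) #|D| + #|P| + #|S| <= #|V| + #|Q|.
Proof.
move=> pP QP; rewrite -(cardsC S) (card_partition pP) (big_setID (A := P) Q) /=.
rewrite (setIidPr QP) -(cardsID Q P) (setIidPr QP).
have arith p q u v w : u <= v -> p + (q + u) + w <= w + (p + v) + q by lia.
apply: arith;
rewrite -sum1_card; apply: leq_sum => D /setDP[DP _]; rewrite card_gt0.
by apply: contraTneq DP => ->; rewrite (partition0 pP).
Qed.

Definition component (V : finType) (r : rel V) (x : V) : {set V} :=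
  [set y | connect r x y].

Lemma component_refl (V : finType) (r : rel V) (x : V) : x \in component r x.
Proof. by rewrite inE. Qed.

Lemma component_closed (V : finType) (r : rel V) (x : V) :
  symmetric r -> closed r (mem (component r x)).
Proof.
move=> rsym y z ryz; rewrite !inE.
exact: (connect_closed (sym_connect_sym rsym) x ryz).
Qed.

Lemma closedC (V : finType) (r : rel V) (X : {set V}) :
  closed r (mem X) -> closed r (mem (~: X)).
Proof. by move=> clX x y rxy; rewrite !inE (clX x y rxy). Qed.

Lemma component_disjoint (V : finType) (r : rel V) (x y z : V) :
  symmetric r -> y \notin component r x -> z \in component r x ->
  z \notin component r y.
Proof.
move=> rsym; rewrite !inE => nxy xz; apply: contra nxy => yz.
by apply: connect_trans xz _; rewrite (sym_connect_sym rsym).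
Qed.

Lemma card_component_disjoint (V : finType) (r : rel V) (x y : V) (S : {set V}) :
  symmetric r -> y \notin component r x ->
  #|component r x :\: S| + #|component r y :\: S| + #|S| <= #|V|.
Proof.
move=> rsym nxy; rewrite -(cardsC S) addnC leq_add2l.
suff /eqP <- : #|(component r x :\: S) :|: (component r y :\: S)| ==
    #|component r x :\: S| + #|component r y :\: S|.
  by apply: subset_leq_card; apply/subsetP=> z; rewrite !inE; case: (z \in S).
rewrite eqn_leq leq_card_setU /= -cardsUI.
suff -> : (component r x :\: S) :&: (component r y :\: S) = set0.
  by rewrite cards0 addn0.
apply/setP=> z; rewrite [RHS]inE; apply/negP.
by case/setIP=> /setDP[zx _] /setDP[zy _]; move: (component_disjoint rsym nxy zx);
   rewrite zy.
Qed.

(* Minimum degree at least 3n/4 in [r || b]: a set containing a vertex and all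
   its neighbours has at least 3n/4 + 1 elements. *)
Definition dense (V : finType) (r b : rel V) : Prop :=
  forall (x : V) (A : {set V}), x \in A ->
    (forall y, r x y || b x y -> y \in A) -> 3 * #|V| + 4 <= 4 * #|A|.

(** Only the first end is tested: for [R] and [B] closed under their colors the other end
    follows. *)
Definition restrict_colors (V : finType) (r b : rel V) (R B : {set V}) : rel V :=
  [rel x y | r x y && (x \in R) || b x y && (x \in B)].

(** All neighbours of [x] lie in [X :|: Y], since red edges do not leave [X] nor blue ones [Y]. *)
Lemma dense_opposite (V : finType) (r b : rel V) (X Y : {set V}) (x : V) :
  dense r b -> closed r (mem X) -> closed b (mem Y) -> x \in X -> x \in Y ->
  4 * #|~: X :&: ~: Y| + 4 <= #|V|.
Proof.
move=> rb clX clY xX xY; have := @rb x (~: (~: X :&: ~: Y)).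
rewrite setCI !setCK inE xX => /(_ isT) le.
have cC := cardsC (X :|: Y); rewrite setCU in cC.
suff /le : forall y, r x y || b x y -> y \in X :|: Y by move: cC; clear; lia.
move=> y; rewrite inE => /orP[/clX <-|/clY <-]; first by rewrite xX.
by rewrite xY orbT.
Qed.

(** If every red component missed at least n/4 vertices, the cut by a blue component would force
    them all below n/4. By the degree condition every blue component would then exceed n/2,
    impossible for two disjoint ones. *)
Lemma large_component (V : finType) (r b : rel V) (y z : V) :
  symmetric r -> symmetric b -> dense r b -> z \notin component b y ->
  exists x, 4 * #|~: component r x| < #|V|.
Proof.
move=> rsym bsym rb yz; apply: NNPP => none.
have rbig x : #|V| <= 4 * #|~: component r x|.
  by rewrite leqNgt; apply/negP => lt; apply: none; exists x.
(* A nonempty cell of the cuts by [X] and [Y] forces the opposite cell below n/4, so some cell is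
   empty. Whichever of [X] and [~: X] contains it then has fewer than n/4 vertices, and [rbig] rules
   out [~: X]. *)
have rsmall x : 4 * #|component r x| < #|V|.
  set X := component r x; set Y := component b y.
  have clX : closed r (mem X) := component_closed x rsym.
  have clY : closed b (mem Y) := component_closed y bsym.
  have clX' := closedC clX; have clY' := closedC clY.
  have opp (A B : {set V}) : closed r (mem A) -> closed b (mem B) ->
      0 < #|A :&: B| -> 4 * #|~: A :&: ~: B| + 4 <= #|V|.
    move=> clA clB /card_gt0P[a /setIP[aA aB]].
    exact: (dense_opposite rb clA clB aA).
  have := opp _ _ clX clY; have := opp _ _ clX clY'.
  have := opp _ _ clX' clY; have := opp _ _ clX' clY'; rewrite !setCK.
  have Ygt0 : 0 < #|Y| by apply/card_gt0P; exists y; apply: component_refl.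
  have Y'gt0 : 0 < #|~: Y| by apply/card_gt0P; exists z; rewrite inE.
  have eX := cardsID Y X; have eX' := cardsID Y (~: X).
  have eY := cardsID X Y; have eY' := cardsID X (~: Y).
  move: eX eX' eY eY' Ygt0 Y'gt0 (rbig x); rewrite -/X !setDE.
  rewrite (setIC Y) (setIC (~: Y) X).
  rewrite (setIC Y) (setIC (~: Y)); have := cardsC X.
  move: #|X| #|Y| #|~: X| #|~: Y| #|V| #|X :&: Y| #|X :&: ~: Y| #|~: X :&: Y|
    #|~: X :&: ~: Y|; clear; lia.
have bbig x : 2 * #|V| < 4 * #|component b x|.
  have := @rb x (component r x :|: component b x).
  rewrite inE component_refl => /(_ isT) le.
  have {le}/le : forall y, r x y || b x y -> y \in component r x :|: component b x.
    by move=> u /orP[] /connect1 xu; rewrite !inE xu ?orbT.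
  have := (leq_card_setU (component r x) (component b x)).1.
  by have := rsmall x; clear; lia.
have := card_component_disjoint set0 bsym yz; rewrite !setD0 cards0.
have := bbig y; have := bbig z; clear; lia.
Qed.

(** * Counting in a barrier *)

Lemma card_barrier (V : finType) (e : rel V) (S : {set V}) (P : {set {set V}}) :
  barrier e S P -> #|S| + 2 <= #|P|.
Proof.
case=> _ _ le; apply: leq_trans le (subset_leq_card _).
by apply/subsetP=> D; rewrite inE => /andP[].
Qed.

Lemma barrier_small (V : finType) (e : rel V) (S : {set V}) (P : {set {set V}}) :
  barrier e S P -> 2 * #|S| + 2 <= #|V|.
Proof.
move=> bar; have := card_barrier bar; case: bar => pP _ _.
by have := sum_blocks pP (sub0set P); rewrite big_set0 cards0; clear; lia.
Qed.

Lemma barrier_block (V : finType) (e : rel V) (S : {set V}) (P : {set {set V}})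
    (x : V) :
  barrier e S P -> x \notin S -> x \in pblock P x /\ pblock P x \in P.
Proof.
case=> pP _ _ xS; have xP : x \in cover P by rewrite (cover_partition pP) inE.
by rewrite mem_pblock xP pblock_mem.
Qed.

Lemma barrier_blockS (V : finType) (e : rel V) (S : {set V})
    (P : {set {set V}}) (D : {set V}) (x : V) :
  barrier e S P -> D \in P -> x \in D -> x \notin S.
Proof.
case=> pP _ _ DP xD; suff : x \in ~: S by rewrite inE.
by rewrite -(cover_partition pP); apply/bigcupP; exists D.
Qed.

(** Besides [D] and [D'] at least |S| blocks remain, each with a vertex; hence the factor 2. *)
Lemma barrier_other_block (V : finType) (e : rel V) (S : {set V})
    (P : {set {set V}}) (D : {set V}) :
  barrier e S P -> D \in P ->
  exists D' x, [/\ D' \in P, x \in D'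
    & #|D| + #|D'| + 2 * #|S| <= #|V| ].
Proof.
move=> bar DP; have kP := card_barrier bar; case: (bar) => pP _ _.
have /card_gt0P[D'] : 0 < #|P :\ D|.
  by move: kP; rewrite (cardsD1 D P) DP add1n addn2 ltnS; apply: leq_trans (ltn0Sn _).
rewrite !inE => /andP[DD' D'P].
have /set0Pn[x xD'] : D' != set0.
  by apply: contraTneq D'P => ->; rewrite (partition0 pP).
exists D', x; split=> //.
have DDP : [set D; D'] \subset P by rewrite subUset !sub1set DP.
have := sum_blocks pP DDP; rewrite big_setU1 ?inE 1?eq_sym // big_set1.
have arith s p d n : s + 2 <= p -> d + p + s <= n + 2 -> d + 2 * s <= n by lia.
by rewrite cards2 eq_sym DD'; apply: arith kP.
Qed.

(** A surviving edge at [x] leads into [D] or [S]; the last two hypotheses take care of the deleted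
    edges. *)
Lemma barrier_nbhd (V : finType) (r b : rel V) (R B S : {set V})
    (P : {set {set V}}) (D A : {set V}) (x : V) :
  dense r b -> barrier (restrict_colors r b R B) S P ->
  D \in P -> x \in D -> D \subset A -> S \subset A ->
  (forall y, r x y -> x \notin R -> y \in A) ->
  (forall y, b x y -> x \notin B -> y \in A) ->
  3 * #|V| + 4 <= 4 * #|A|.
Proof.
move=> rb [pP cross _] DP xD /subsetP DA /subsetP SA rA bA.
apply: (rb x); first exact: DA.
move=> y xy; have [/SA//|yS] := boolP (y \in S).
have D_A : restrict_colors r b R B x y -> y \in A.
  by move=> exy; apply: DA; apply: cross exy.
case/orP: xy => xy.
  have [xR|/rA] := boolP (x \in R); last exact.
  by apply: D_A; rewrite /restrict_colors /= xy xR.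
have [xB|/bA] := boolP (x \in B); last exact.
by apply: D_A; rewrite /restrict_colors /= xy xB orbT.
Qed.

(** * Excluding barriers *)

(** A vertex of [R] and [B] loses no edge, so its block and [S] exceed 3n/4; so do another block and
    [S], up to the fewer than n/2 vertices missed by [R] or [B]. Together this contradicts |D| +
    |D'| + 2|S| <= n. *)
Lemma no_barrier_large (V : finType) (r b : rel V) (R B S : {set V})
    (P : {set {set V}}) :
  dense r b -> closed r (mem R) -> closed b (mem B) ->
  4 * #|~: R| < #|V| -> 4 * #|~: B| < #|V| ->
  ~ barrier (restrict_colors r b R B) S P.
Proof.
move=> rb clR clB ltR ltB bar; have sS := barrier_small bar.
(* [~: S] has more than n/2 vertices, [~: R :|: ~: B] fewer. *)
have /subsetPn[x xS xRB] : ~~ (~: S \subset ~: R :|: ~: B).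
  apply/negP => /subset_leq_card; have := (leq_card_setU (~: R) (~: B)).1.
  by have := cardsC S; move: sS ltR ltB; clear; lia.
move: xS xRB; rewrite !inE negb_or !negbK => xS /andP[xR xB].
have [xD DP] := barrier_block bar xS.
have [D' [y [D'P yD' DD']]] := barrier_other_block bar DP.
have leD : 3 * #|V| + 4 <= 4 * #|S :|: pblock P x|.
  apply: (barrier_nbhd rb bar DP xD); rewrite ?subsetUl ?subsetUr // => z _.
    by rewrite xR.
  by rewrite xB.
have leD' : 3 * #|V| + 4 <= 4 * #|(S :|: D') :|: (~: R :|: ~: B)|.
  apply: (barrier_nbhd rb bar D'P yD').
  - by rewrite -setUA setUCA subsetUl.
  - by rewrite -setUA subsetUl.
  - by move=> z /clR yz; rewrite !inE -yz => ->; rewrite !orbT.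
  - by move=> z /clB yz; rewrite !inE -yz => ->; rewrite !orbT.
have := (leq_card_setU S (pblock P x)).1.
have := (leq_card_setU (S :|: D') (~: R :|: ~: B)).1.
have := (leq_card_setU S D').1; have := (leq_card_setU (~: R) (~: B)).1.
by move: leD leD' DD' ltR ltB; clear; lia.
Qed.

(** An odd block has at least three vertices unless it is a singleton, which is credited with two
    more. *)
Lemma card_odd_singletons (V : finType) (S : {set V}) (P : {set {set V}}) :
  partition P (~: S) ->
  3 * #|[set D in P | odd #|D| ]| + #|S| <= #|V| + 2 * #|[set x | [set x] \in P]|.
Proof.
move=> pP; set Q := [set D in P | _]; set T := [set x | _].
have QP : Q \subset P by apply/subsetP=> D; rewrite inE => /andP[].
have sQ := sum_blocks pP QP; have cQ := subset_leq_card QP.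
pose Q1 := [set D in Q | #|D| == 1].
have cQ1 : #|Q1| <= #|T|.
  apply: leq_trans (leq_imset_card (fun x => [set x]) T).
  apply: subset_leq_card; apply/subsetP=> D; rewrite !inE => /andP[/andP[DP _]].
  by case/cards1P=> x E; apply/imsetP; exists x; rewrite // inE -E.
have le3 : \sum_(D in Q) 3 <= \sum_(D in Q) (#|D| + 2 * (#|D| == 1)).
  apply: leq_sum => D; rewrite inE => /andP[_].
  by case: #|D| => [|[|[|m]]].
rewrite big_split -big_distrr /= in le3.
have sQ1 : \sum_(D in Q) (#|D| == 1) = #|Q1|.
  rewrite -sum1_card big_mkcond [RHS]big_mkcond; apply: eq_bigr => D _.
  by rewrite [D \in Q1]in_set; case: (D \in Q) => //=; case: (_ == 1).
rewrite sQ1 sum_nat_const in le3.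
have arith t p s n q q1 m : t + p + s <= n + q -> q1 <= m -> q * 3 <= t + 2 * q1 ->
  q <= p -> 3 * q + s <= n + 2 * m by lia.
exact: arith sQ cQ1 le3 cQ.
Qed.

Lemma no_barrier_spanning (V : finType) (r b : rel V) (R : {set V}) (y0 : V)
    (S : {set V}) (P : {set {set V}}) :
  symmetric r -> symmetric b -> dense r b -> (forall x, x \in R) ->
  (forall x, #|component b x| <= #|component b y0|) ->
  ~ barrier (restrict_colors r b R (component b y0)) S P.
Proof.
move=> rsym bsym rb RT; set B := component b y0 => Bmax bar.
have kP := card_barrier bar; have sS := barrier_small bar.
case: (bar) => pP cross kQ.
(* No red edge is deleted, and a blue edge at [x] only if [x] is outside [B]; that edge stays in the
   blue component of [x]. *)
have nbhd D x : D \in P -> x \in D ->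
    3 * #|V| + 4 <= 4 * #|S :|: (D :|: if x \in B then set0 else component b x)|.
  move=> DP xD; apply: (barrier_nbhd rb bar DP xD).
  - by rewrite setUCA subsetUl.
  - exact: subsetUl.
  - by move=> z _; rewrite RT.
  - by move=> z /connect1 xz /negPf ->; rewrite !inE xz !orbT.
have cU3 (D : {set V}) x : x \in D ->
    #|S :|: (D :|: component b x)| + 1 <= #|S| + (#|D| + #|component b x|).
  move=> xD; have := (leq_card_setU S (D :|: component b x)).1.
  have : 0 < #|D :&: component b x|.
    by apply/card_gt0P; exists x; rewrite inE xD component_refl.
  by have := cardsUI D (component b x); clear; lia.
(* The degree bounds at vertices of two blocks sum to more than 3n/2, while the blocks and twice [S]
   take at most n. The excess would need a component disjoint from [B] with over n/2 vertices,
   against maximality. *)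
have BS : B \subset S.
  apply/subsetP=> x xB; apply/negPn/negP => xS.
  have [xD DP] := barrier_block bar xS.
  have [D' [y [D'P yD' DD']]] := barrier_other_block bar DP.
  have := nbhd _ _ DP xD; rewrite xB setU0 => leD.
  have cD := (leq_card_setU S (pblock P x)).1.
  have := nbhd _ _ D'P yD'; case: ifP => [_|/negbT yB] leD'.
    have cD' := (leq_card_setU S D').1.
    by move: leD cD leD' cD' DD'; rewrite setU0; clear; lia.
  have := card_component_disjoint set0 bsym yB; rewrite !setD0 cards0.
  move: (Bmax y) (cU3 _ _ yD') leD cD leD' DD'; rewrite -/B; clear; lia.
have nB x : x \notin S -> x \in B = false.
  by move=> xS; apply: contraNF xS => /(subsetP BS).
have sgt0 : 0 < #|S|.
  by apply/card_gt0P; exists y0; apply: (subsetP BS); apply: component_refl.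
have cS x : #|component b x| <= #|S|.
  exact: leq_trans (Bmax x) (subset_leq_card BS).
have bigD D : D \in P -> 3 * #|V| + 8 <= 8 * #|S| + 4 * #|D|.
  move=> DP; have /set0Pn[x xD] : D != set0.
    by apply: contraTneq DP => ->; rewrite (partition0 pP).
  have := nbhd D x DP xD; rewrite nB; last exact: barrier_blockS bar DP xD.
  by move: (cU3 D x xD) (cS x); clear; lia.
pose T := [set x | [set x] \in P].
have cT := card_odd_singletons pP; rewrite -/T in cT.
have TS x : x \in T -> x \notin S.
  by rewrite inE => xP; apply: barrier_blockS bar xP (set11 x).
have big1 x : x \in T -> 3 * #|V| + 4 <= 4 * (#|S| + #|component b x :\: S|).
  move=> xT; have xP := xT; rewrite inE in xP.
  have := nbhd _ x xP (set11 x); rewrite nB ?TS //.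
  suff -> : S :|: ([set x] :|: component b x) = S :|: (component b x :\: S).
    by have := (leq_card_setU S (component b x :\: S)).1; clear; lia.
  apply/setP=> y; rewrite !inE; case: (y \in S) => //=.
  by have [->|] := eqVneq y x; rewrite ?connect0.
have [T0|[x xT]] := set_0Vmem T.
  (* Without singleton blocks, 4s + 6 <= n for s = |S|, and s + 2 odd blocks of at least (3n + 8 -
     8s)/4 vertices each do not fit into [~: S]. *)
  rewrite T0 cards0 in cT; set Q := [set D in P | _] in cT kQ.
  have QP : Q \subset P by apply/subsetP=> D; rewrite inE => /andP[].
  have := sum_blocks pP QP; have := subset_leq_card QP.
  have : \sum_(D in Q) (3 * #|V| + 8) <= \sum_(D in Q) (8 * #|S| + 4 * #|D|).
    by apply: leq_sum => D DQ; apply: bigD; apply: (subsetP QP).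
  rewrite sum_nat_const big_split /= sum_nat_const -big_distrr /=.
  have arith q p s n t : 0 < s -> s + 2 <= q -> 3 * q + s <= n + 2 * 0 ->
      q * (3 * n + 8) <= q * (8 * s) + 4 * t -> q <= p -> ~ t + p + s <= n + q.
    move=> s0 sq qn; have -> : 3 * n + 8 = 8 * s + (3 * n + 8 - 8 * s) by lia.
    rewrite mulnDr leq_add2l => qt qp tn.
    have : (s.-1 + 3) * (3 * n + 8 - 8 * s) <= 4 * t.
      by apply: leq_trans qt; rewrite leq_mul2r; apply/orP; right; lia.
    by case: s s0 sq qn tn {qt} => [|[|s]] //=; nia.
  exact: arith sgt0 kQ cT.
have Cx := big1 x xT.
have /subsetPn[u] : ~~ (~: S \subset component b x).
  apply/negP=> /subset_leq_card; move: (cS x) (cardsC S) sS; clear; lia.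
rewrite inE => uS ux; have [uD DP] := barrier_block bar uS.
(* Two blue components meeting [T] would each have at least 3n/4 + 1 - |S| vertices outside [S], too
   many as |S| < n/2. *)
have TC y : y \in T -> y \in component b x.
  move=> yT; apply/negPn/negP => yx.
  have := card_component_disjoint S bsym yx.
  by move: Cx (big1 y yT) sS; clear; lia.
(* [u] has no neighbour in [T]: a red edge would survive and put [u] into a singleton block, a blue
   one into the component of [x]. *)
have : 3 * #|V| + 4 <= 4 * #|~: T|.
  apply: (rb u); first by rewrite inE; apply: contra ux; apply: TC.
  move=> y uy; rewrite inE; apply/negP=> yT.
  have yx := TC y yT; have yS := TS y yT.
  have uPy : pblock P u != [set y].
    by apply: contraNneq ux => E; move: uD; rewrite E inE => /eqP->.
  have buy : ~~ restrict_colors r b R B u y.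
    apply: contra uPy => /(cross _ _ _ DP uD yS) yD.
    apply/eqP; rewrite -(def_pblock (partition_trivIset pP) DP yD).
    apply: def_pblock (partition_trivIset pP) _ (set11 y).
    by move: yT; rewrite inE.
  case/orP: uy => uy.
    by move: buy; rewrite /restrict_colors /= uy RT.
  by move: (component_closed x bsym uy) ux; rewrite yx => ->.
(* For s = |S|: 8s >= 3n + 4 and 4s + 6 <= n + 2|T| give 4|T| >= n + 16, but the degree of [u] gives
   4|T| <= n - 4. *)
by move: (cardsC T) cT kQ Cx (cS x) (subset_leq_card (subsetDl (component b x) S));
   clear; lia.
Qed.

(** * Choice of the two components *)

Lemma restrict_colors_sym (V : finType) (r b : rel V) (R B : {set V}) :
  symmetric r -> symmetric b -> closed r (mem R) -> closed b (mem B) ->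
  symmetric (restrict_colors r b R B).
Proof.
move=> rsym bsym clR clB x y; rewrite /restrict_colors /= rsym bsym; congr (_ || _).
  by apply: andb_id2l => /clR; rewrite /= => ->.
by apply: andb_id2l => /clB; rewrite /= => ->.
Qed.

Lemma pairing_of_no_barrier (V : finType) (r b : rel V) (x y : V) :
  symmetric r -> symmetric b -> irreflexive r -> irreflexive b -> ~~ odd #|V| ->
  (forall S P,
    ~ barrier (restrict_colors r b (component r x) (component b y)) S P) ->
  exists f, perfect_pairing
    (restrict_colors r b (component r x) (component b y)) f.
Proof.
move=> rsym bsym rirr birr evV nobar.
have [||//|//|[S [P bar]]] :=
  @tutte V (restrict_colors r b (component r x) (component b y)).
- by apply: restrict_colors_sym; rewrite //; apply: component_closed.
- by move=> z; rewrite /restrict_colors /= rirr birr.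
by case: (nobar S P).
Qed.

Lemma pairing_spanning (V : finType) (r b : rel V) (x : V) :
  symmetric r -> symmetric b -> irreflexive r -> irreflexive b -> dense r b ->
  ~~ odd #|V| -> (forall y, y \in component r x) ->
  exists y f, perfect_pairing
    (restrict_colors r b (component r x) (component b y)) f.
Proof.
move=> rsym bsym rirr birr rb evV rx.
case: (@arg_maxnP V x predT (fun y => #|component b y|) isT) => y _ ymax.
exists y; apply: pairing_of_no_barrier => // S P.
by apply: no_barrier_spanning => // z; apply: ymax.
Qed.

Lemma two_component_pairing (V : finType) (r b : rel V) (x0 : V) :
  symmetric r -> symmetric b -> irreflexive r -> irreflexive b -> dense r b ->
  ~~ odd #|V| ->
  exists x y f, perfect_pairing
    (restrict_colors r b (component r x) (component b y)) f.
Proof.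
move=> rsym bsym rirr birr rb evV.
have br : dense b r.
  by move=> x A xA bA; apply: (rb x A xA) => y; rewrite orbC; apply: bA.
have [/forallP rx|/forallPn[z xz]] := boolP [forall y, y \in component r x0].
  by have [y [f fP]] := pairing_spanning rsym bsym rirr birr rb evV rx; exists x0, y, f.
have [/forallP bx|/forallPn[t xt]] := boolP [forall y, y \in component b x0].
  have [y [f [fK fP]]] := pairing_spanning bsym rsym birr rirr br evV bx.
  by exists y, x0, f; split=> // u; have := fP u; rewrite /restrict_colors /= orbC.
(* Disconnection of either color yields the large component of the other. *)
have [x ltx] := large_component rsym bsym rb xt.
have [y lty] := large_component bsym rsym br xz.
exists x, y; apply: pairing_of_no_barrier => // S P.
by apply: no_barrier_large => //; apply: component_closed.
Qed.

(** * From pairings to matchings as sets of edges *)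

Lemma color_adj_adj (V : finType) (adj : rel V) (col : {set V} -> color)
    (a : color) (x y : V) :
  simple_graph adj -> color_adj adj col a x y =
  adj x y && same_color (col [set x; y]) a.
Proof.
case=> asym airr; rewrite /color_adj /= inE; congr (_ && _).
apply/imset2P/idP => [[u v _]|xy]; last by exists x y; rewrite ?inE.
rewrite inE => /andP[_ uv] E.
have uv' : u != v by apply: contraTneq uv => ->; rewrite airr.
have := set21 u v; have := set22 u v; rewrite -E !inE.
case/orP=> /eqP Ev; case/orP=> /eqP Eu; move: uv uv'; rewrite Eu Ev ?eqxx //.
by rewrite asym.
Qed.

Lemma color_adj_sym (V : finType) (adj : rel V) (col : {set V} -> color)
    (a : color) : symmetric (color_adj adj col a).
Proof. by move=> x y; rewrite /color_adj /= setUC. Qed.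

Lemma min_degree_le (V : finType) (adj : rel V) (x : V) :
  min_degree adj <= degree adj x.
Proof.
rewrite /min_degree; have := mem_index_enum x.
elim: (index_enum V) => // y s IH; rewrite inE big_cons geq_min.
by case/predU1P => [->|/IH ->]; rewrite ?leqnn ?orbT.
Qed.

(** Every edge is red or blue, so [A :\ x] contains the neighbourhood of [x]; the vertex [x] itself
    accounts for the [+ 4] in [dense]. *)
Lemma color_adj_dense (V : finType) (adj : rel V) (col : {set V} -> color) :
  simple_graph adj -> 3 * #|V| <= 4 * min_degree adj ->
  dense (color_adj adj col red) (color_adj adj col blue).
Proof.
move=> gadj deg x A xA nA; have [_ airr] := gadj.
have : degree adj x <= #|A :\ x|.
  apply: subset_leq_card; apply/subsetP=> y; rewrite !inE => xy; apply/andP; split.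
    by apply: contraTneq xy => ->; rewrite airr.
  by apply: nA; rewrite !color_adj_adj // xy; case: (col _).
by have := min_degree_le adj x; rewrite (cardsD1 x A) xA; move: deg; clear; lia.
Qed.

Definition pairing_blocks (V : finType) (f : V -> V) (U : {set V}) : {set {set V}} :=
  [set [set v; f v] | v in U].

(** The block containing z is always {z, f z}, whichever end produced it. *)
Lemma pairing_blocks_trivIset (V : finType) (f : V -> V) (U : {set V}) :
  involutive f -> trivIset (pairing_blocks f U).
Proof.
move=> fK; apply/trivIsetP => _ _ /imsetP[u _ ->] /imsetP[v _ ->].
have eqB z w : z \in [set w; f w] -> [set w; f w] = [set z; f z].
  by rewrite !inE => /orP[]/eqP-> //; rewrite fK setUC.
apply: contraR => /pred0Pn[z /andP[/= /eqB -> /eqB ->]].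
by rewrite eqxx.
Qed.

Lemma cover_pairing_blocks (V : finType) (f : V -> V) (U : {set V}) :
  {in U, forall x, f x \in U} -> cover (pairing_blocks f U) = U.
Proof.
move=> fU; apply/setP=> x; apply/bigcupP/idP => [[_ /imsetP[u uU ->]]|xU].
  by rewrite !inE => /orP[]/eqP-> //; apply: fU.
by exists [set x; f x]; [apply: imset_f | apply: set21].
Qed.

Lemma connected_pairing_blocks (V : finType) (adj : rel V)
    (col : {set V} -> color) (a : color) (f : V -> V) (U : {set V}) (x : V) :
  involutive f -> {in U, forall v, f v \in U} ->
  {in U, forall v, color_adj adj col a v (f v)} ->
  U \subset component (color_adj adj col a) x ->
  connected_matching adj col a (pairing_blocks f U).
Proof.
move=> fK fU aU UC.
have sub : pairing_blocks f U \subset color_edges adj col a.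
  by apply/subsetP=> _ /imsetP[v vU ->]; apply: aU.
split=> //.
  split; last exact: pairing_blocks_trivIset.
  by apply/subsetP=> D /(subsetP sub); rewrite inE => /andP[].
right; exists (component (color_adj adj col a) x).
  by apply/imsetP; exists x; rewrite ?inE //; apply/setP=> y; rewrite !inE.
by rewrite cover_pairing_blocks.
Qed.

Theorem theorem12 (V : finType) (adj : rel V) (n : nat) (col : {set V} -> color)
    (hG : simple_graph adj) (hn : #|V| = n) (hdeg : 3 * n <= 4 * min_degree adj)
    (hev : ~~ odd n) :
  exists MR MB : {set {set V}},
    [/\ connected_matching adj col red MR,
        connected_matching adj col blue MB,
        [disjoint cover MR & cover MB]
      & perfect_matching adj (MR :|: MB)].
Proof.
(* Without vertices no component can be chosen, and two empty matchings serve. *)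
have [x0 _|V0] := pickP V; last first.
  have M0 a : connected_matching adj col a set0.
    split; last by left.
      by split; [apply: sub0set | apply/trivIsetP=> A B; rewrite inE].
    exact: sub0set.
  exists set0, set0; split=> //.
    by rewrite -setI_eq0 /cover big_set0 setI0.
  split; first by rewrite setU0; case: (M0 red).
  by apply/setP=> x; have := V0 x.
rewrite -hn in hdeg hev.
pose r := color_adj adj col red; pose b := color_adj adj col blue.
have rsym : symmetric r by apply: color_adj_sym.
have bsym : symmetric b by apply: color_adj_sym.
have irr a : irreflexive (color_adj adj col a).
  by move=> x; rewrite color_adj_adj //; case: hG => _ ->.
have [x [y [f [fK fP]]]] := two_component_pairing x0 rsym bsym (irr red) (irr blue)
  (color_adj_dense hG hdeg) hev.
(* [U] collects the ends of the pairs that are red inside the red component; it is stable under [f],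
   and all other pairs are blue inside the blue component. *)
pose U := [set v | r v (f v) && (v \in component r x)].
have fU v : (f v \in U) = (v \in U).
  rewrite !inE fK rsym; apply: andb_id2l => /(component_closed x rsym) /=.
  by rewrite !inE.
have fU1 : {in U, forall v, f v \in U} by move=> v; rewrite fU.
have fU2 : {in ~: U, forall v, f v \in ~: U} by move=> v; rewrite !(in_setC, fU).
have blueU v : v \in ~: U -> b v (f v) && (v \in component b y).
  by rewrite !in_set => /negPf nU; have := fP v; rewrite /restrict_colors /= !in_set nU.
have MR : connected_matching adj col red (pairing_blocks f U).
  apply: (@connected_pairing_blocks _ _ _ _ _ _ x) => //.
    by move=> v; rewrite inE => /andP[].
  by apply/subsetP=> v; rewrite inE => /andP[].
have MB : connected_matching adj col blue (pairing_blocks f (~: U)).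
  apply: (@connected_pairing_blocks _ _ _ _ _ _ y) => //.
    by move=> v /blueU/andP[].
  by apply/subsetP=> v /blueU/andP[].
exists (pairing_blocks f U), (pairing_blocks f (~: U)); split=> //.
  by rewrite !cover_pairing_blocks // -setI_eq0 setICr.
have -> : pairing_blocks f U :|: pairing_blocks f (~: U) = pairing_blocks f setT.
  by rewrite /pairing_blocks -imsetU setUCr.
split; last by apply: cover_pairing_blocks => v; rewrite !inE.
split; last exact: pairing_blocks_trivIset.
rewrite /pairing_blocks -(setUCr U) imsetU subUset.
by case: MR => [[-> _] _ _]; case: MB => [[-> _] _ _].
Qed.
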